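(* Let $G_1$ be a proper rational $p_1\times m_1$ matrix function and $g_2$ a proper rational scalar function with state space realizations $$G_1(s)=D_1+C_1(sI_{n_1}-A_1)^{-1}B_1,\qquad g_2(s)=d_2+c_2(sI_{n_2}-A_2)^{-1}b_2,$$ where $A_1\in\mathbb{C}^{n_1\times n_1}$, $B_1\in\mathbb{C}^{n_1\times m_1}$, $C_1\in\mathbb{C}^{p_1\times n_1}$, $D_1\in\mathbb{C}^{p_1\times m_1}$, $A_2\in\mathbb{C}^{n_2\times n_2}$, $b_2\in\mathbb{C}^{n_2\times 1}$, $c_2\in\mathbb{C}^{1\times n_2}$, $d_2\in\mathbb{C}$. Assume that $d_2$ is not an eigenvalue of $A_1$. Then the composition $G=G_1\circ g_2$, $G(s)=G_1(g_2(s))$, is again a proper rational (matrix) function, and $G(s)=D+C(sI_{n_1n_2}-A)^{-1}B$ with $$\begin{aligned} A&=I_{n_1}\otimes A_2+(A_1-d_2I_{n_1})^{-1}\otimes b_2c_2\in\mathbb{C}^{n_1n_2\times n_1n_2},\\ B&=-(A_1-d_2I_{n_1})^{-1}B_1\otimes b_2\in\mathbb{C}^{n_1n_2\times m_1},\\ C&=C_1(A_1-d_2I_{n_1})^{-1}\otimes c_2\in\mathbb{C}^{p_1\times n_1n_2},\\ D&=D_1-C_1(A_1-d_2I_{n_1})^{-1}B_1\in\mathbb{C}^{p_1\times m_1}. \end{aligned}$$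
   Context: $\otimes$ denotes the Kronecker product of matrices; ordinary matrix products are formed before Kronecker products, e.g. $-(A_1-d_2I_{n_1})^{-1}B_1\otimes b_2$ means $\bigl(-(A_1-d_2I_{n_1})^{-1}B_1\bigr)\otimes b_2$. A rational (matrix) function is proper if it has no pole at infinity, i.e. it has a finite limit as $s\to\infty$. Equalities between rational functions are understood as identities of rational functions in $s$. *)

(* Defs.v *)
From HB Require Import structures.
From mathcomp Require Import all_boot all_order all_algebra.
From mathcomp Require Import generic_quotient.
From mathcomp Require Import reals.
From mathcomp Require Import complex mxtens.

Set Implicit Arguments.
Unset Strict Implicit.
Unset Printing Implicit Defensive.

Import Order.TTheory GRing.Theory Num.Theory.

Local Open Scope ring_scope.
Local Open Scope complex_scope.

Notation "p %:F" := (@FracField.tofrac _ p) : ring_scope.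

Notation ratfun F := {fraction {poly F}}.

Section RationalFunctions.
Variable F : fieldType.
Implicit Types (r g : ratfun F) (c z : F).

Definition ratc c : ratfun F := (c%:P)%:F.

(* The representative chosen by [repr] need not be in lowest terms, hence the
   division by the gcd: a root of [rden r] is a genuine pole of [r]. *)
Definition rnum r : {poly F} :=
  \n_(repr r) %/ gcdp \n_(repr r) \d_(repr r).
Definition rden r : {poly F} :=
  \d_(repr r) %/ gcdp \n_(repr r) \d_(repr r).

Lemma coprimep_rnum_rden r : coprimep (rnum r) (rden r).
Proof. by rewrite coprimep_div_gcd // denom_ratioP orbT. Qed.

Lemma rden_neq0 r : rden r != 0.
Proof.
have dn0 := denom_ratioP (repr r).
by rewrite /rden dvdp_div_eq0 ?dvdp_gcdr.
Qed.

Lemma rnum_div_rden r : (rnum r)%:F / (rden r)%:F = r.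
Proof.
set x := repr r; set d := gcdp \n_x \d_x.
have dx0 : \d_x != 0 := denom_ratioP x.
have nE : \n_x = rnum r * d by rewrite divpK ?dvdp_gcdl.
have dE : \d_x = rden r * d by rewrite divpK ?dvdp_gcdr.
have d0 : d != 0 by rewrite gcdp_eq0 negb_and dx0 orbT.
have xE : r = (\n_x)%:F / (\d_x)%:F.
  apply: (@mulIf _ (\d_x)%:F); first by rewrite tofrac_eq0.
  rewrite divfK ?tofrac_eq0 // -{1}[r]reprK -/x; unlock FracField.tofrac.
  rewrite -[LHS]FracField.pi_mul; apply/eqmodP.
  rewrite /= FracField.equivfE /FracField.mulf !numden_Ratio ?mulf_neq0 ?oner_eq0 //.
  by rewrite !mulr1 mulrC.
rewrite [RHS]xE nE dE !rmorphM /= -mulf_div divff ?mulr1 //.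
by rewrite tofrac_eq0.
Qed.

Definition rval r z : F := (rnum r).[z] / (rden r).[z].

(* Substitution r(g(s)); it makes sense when the denominator of [r] does not
   vanish at [g], which can fail only if [g] is constant. *)
Definition rcomp_def r g : Prop := (map_poly ratc (rden r)).[g] != 0.
Definition rcomp r g : ratfun F :=
  (map_poly ratc (rnum r)).[g] / (map_poly ratc (rden r)).[g].

Definition mxrcomp_def p m (G : 'M[ratfun F]_(p, m)) g : Prop :=
  forall i j, rcomp_def (G i j) g.
Definition mxrcomp p m (G : 'M[ratfun F]_(p, m)) g : 'M[ratfun F]_(p, m) :=
  map_mx (rcomp^~ g) G.

(* D + C (s I - A)^-1 B; the matrix [s I - A] is always invertible over the
   field of rational functions. *)
Definition realization n p m (A : 'M[F]_n) (B : 'M[F]_(n, m))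
    (C : 'M[F]_(p, n)) (D : 'M[F]_(p, m)) : 'M[ratfun F]_(p, m) :=
  map_mx ratc D
  + map_mx ratc C *m invmx (('X%:F)%:M - map_mx ratc A) *m map_mx ratc B.

End RationalFunctions.

Section Proper.
Variable R : realType.

Definition has_limit_at_infty (r : ratfun R[i]) (l : R[i]) : Prop :=
  forall e : R, 0 < e -> exists M : R, forall z : R[i],
    M%:C < `|z| -> (rden r).[z] != 0 -> `|rval r z - l| < e%:C.

Definition rproper (r : ratfun R[i]) : Prop :=
  exists l : R[i], has_limit_at_infty r l.

Definition mxrproper p m (G : 'M[ratfun R[i]]_(p, m)) : Prop :=
  forall i j, rproper (G i j).

End Proper.

(* Kronecker products with a column, resp. a row: [*t] yields a matrix with
   [m * 1] columns, resp. [p * 1] rows. *)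
Definition kron_col (K : pzRingType) n1 m n2
    (A : 'M[K]_(n1, m)) (b : 'cV[K]_n2) : 'M[K]_(n1 * n2, m) :=
  castmx (erefl, muln1 m) (A *t b).
Definition kron_row (K : pzRingType) p n1 n2
    (A : 'M[K]_(p, n1)) (c : 'rV[K]_n2) : 'M[K]_(p, n1 * n2) :=
  castmx (muln1 p, erefl) (A *t c).

(* Main.v *)
(** Write [G1 = D1 + P / q] with [q] the characteristic polynomial of [A1] and
    [P = C1 adj(s I - A1) B1] of smaller degree.  Evaluating this polynomial
    identity at [g2] gives [G1(g2) = D1 + C1 (g2 I - A1)^-1 B1], provided
    [q(g2) <> 0].  As [q] splits, [q(g2) = 0] would force [g2] to be a constant
    eigenvalue of [A1]; but [g2 - d2] is strictly proper, so that constant would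
    be [d2].  The realization of [G1(g2)] is then checked by exhibiting its
    state, the Kronecker product of the states of [G1] (at [g2]) and of [g2]. *)
From HB Require Import structures.
Require Import Defs.
From mathcomp Require Import all_boot all_order all_algebra.
From mathcomp Require Import reals complex mxtens.
Set Implicit Arguments.
Unset Strict Implicit.
Unset Printing Implicit Defensive.

Import Order.TTheory GRing.Theory Num.Theory.
Local Open Scope ring_scope.
Local Open Scope complex_scope.

(** * Degree bounds for the resolvent as a polynomial matrix over [char_poly A] *)

Section PolynomialMatrices.
Variable F : fieldType.

Lemma size_signrM k (p : {poly F}) : size ((-1) ^+ k * p) = size p.
Proof. by rewrite -signr_odd mulr_sign; case: ifP => // _; rewrite size_polyN. Qed.

(** Each term of the Leibniz expansion is, up to sign, a product of [n] polynomials of degree at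
    most 1. *)
Lemma size_det_affine_leq n (M : 'M[{poly F}]_n) :
  (forall i j, size (M i j) <= 2)%N -> (size (\det M) <= n.+1)%N.
Proof.
move=> M2; apply: leq_trans (size_sum _ _ _) _; apply/bigmax_leqP => s _.
rewrite size_signrM; apply: leq_trans (size_poly_prod_leq _ _) _; rewrite card_ord leq_subLR.
rewrite addnS ltnS addnn -muln2 -[X in (_ <= X * _)%N]card_ord -sum_nat_const.
exact: leq_sum.
Qed.

Lemma size_adj_char_poly_mx n (A : 'M[F]_n) i j :
  (size (\adj (char_poly_mx A) i j) <= n)%N.
Proof.
case: n A i j => [|n] A i j; first by case: i.
rewrite mxE /cofactor size_signrM.
apply: size_det_affine_leq => k l; rewrite !mxE.
apply: leq_trans (size_polyD _ _) _; rewrite geq_max size_polyN.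
rewrite (leq_trans (size_polyC_leq1 _)) // andbT.
by case: eqP; rewrite ?size_polyX ?size_poly0.
Qed.

Lemma size_mulmx_leq m n p k (M : 'M[{poly F}]_(m, n)) (B : 'M[F]_(n, p)) :
  (forall i j, size (M i j) <= k)%N ->
  forall i j, (size ((M *m map_mx polyC B) i j) <= k)%N.
Proof.
move=> Mk i j; rewrite mxE; apply: leq_trans (size_sum _ _ _) _.
apply/bigmax_leqP => l _; rewrite mxE mulrC mul_polyC.
exact: leq_trans (size_scale_leq _ _) (Mk _ _).
Qed.

Lemma size_lmulmx_leq m n p k (C : 'M[F]_(m, n)) (M : 'M[{poly F}]_(n, p)) :
  (forall i j, size (M i j) <= k)%N ->
  forall i j, (size ((map_mx polyC C *m M) i j) <= k)%N.
Proof.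
move=> Mk i j; rewrite mxE; apply: leq_trans (size_sum _ _ _) _.
apply/bigmax_leqP => l _; rewrite mxE mul_polyC.
exact: leq_trans (size_scale_leq _ _) (Mk _ _).
Qed.

(** By Cramer's rule, the numerator of C (s I - A)^-1 B over the common denominator
    [char_poly A]. *)
Definition transfer_num n p m (A : 'M[F]_n) (B : 'M[F]_(n, m)) (C : 'M[F]_(p, n)) :
    'M[{poly F}]_(p, m) :=
  map_mx polyC C *m \adj (char_poly_mx A) *m map_mx polyC B.

Lemma size_transfer_num n p m (A : 'M[F]_n) (B : 'M[F]_(n, m)) (C : 'M[F]_(p, n)) i j :
  (size (transfer_num A B C i j) < size (char_poly A))%N.
Proof.
rewrite size_char_poly ltnS.
apply: size_mulmx_leq; apply: size_lmulmx_leq; exact: size_adj_char_poly_mx.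
Qed.

Lemma char_poly_neq0 n (A : 'M[F]_n) : char_poly A != 0.
Proof. exact/monic_neq0/char_poly_monic. Qed.

(* A single computation covers both [f = tofrac], which gives the realization
   itself, and [f] = evaluation at [g], which gives its composition with [g]. *)
Lemma map_transfer_num (K : fieldType) (f : {rmorphism {poly F} -> K})
    n p m (A : 'M[F]_n) (B : 'M[F]_(n, m)) (C : 'M[F]_(p, n)) :
  let h := f \o polyC in
  f (char_poly A) != 0 ->
  (f 'X)%:M - map_mx h A \in unitmx /\
  map_mx h C *m invmx ((f 'X)%:M - map_mx h A) *m map_mx h B
  = (f (char_poly A))^-1 *: map_mx f (transfer_num A B C).
Proof.
move=> h pf0.
have E : map_mx f (char_poly_mx A) = (f 'X)%:M - map_mx h A.
  by rewrite map_mxB map_scalar_mx -map_mx_comp.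
have detE : \det ((f 'X)%:M - map_mx h A) = f (char_poly A).
  by rewrite -E det_map_mx.
have uE : (f 'X)%:M - map_mx h A \in unitmx by rewrite unitmxE detE unitfE.
split=> //; rewrite /invmx uE detE -scalemxAr -scalemxAl -E -map_mx_adj.
by rewrite !map_mxM -!map_mx_comp.
Qed.

End PolynomialMatrices.

(** * Substitution into rational functions and into realizations *)

Section RationalFunctions.
Variable F : fieldType.
Local Notation K := (ratfun F).

Lemma ratc_is_additive : zmod_morphism (@ratc F).
Proof. by move=> a b; rewrite /ratc polyCB rmorphB. Qed.
Lemma ratc_is_multiplicative : monoid_morphism (@ratc F).
Proof. by split=> [|a b]; rewrite /ratc ?rmorph1 // polyCM rmorphM. Qed.
HB.instance Definition _ := GRing.isZmodMorphism.Build F K (@ratc F) ratc_is_additive.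
HB.instance Definition _ := GRing.isMonoidMorphism.Build F K (@ratc F) ratc_is_multiplicative.

(** Substitution of [g] packaged as a ring morphism, so that [map_transfer_num] applies; it unfolds
    to the expression used in [rcomp]. *)
Definition evalr (g : K) : {poly F} -> K :=
  horner_morph (f := @ratc F) (fun a => mulrC g (ratc a)).
HB.instance Definition _ g := GRing.RMorphism.on (evalr g).

Lemma evalrX g : evalr g 'X = g.
Proof. exact: horner_morphX. Qed.

Lemma evalrC g c : evalr g c%:P = ratc c.
Proof. exact: horner_morphC. Qed.

Lemma rnum_cross (r : K) (p q : {poly F}) :
  q%:F * r = p%:F -> rnum r * q = rden r * p.
Proof.
move=> rE; apply/eqP; rewrite -tofrac_eq !rmorphM /= -rE.
have d0 : (rden r)%:F != 0 :> K by rewrite tofrac_eq0 rden_neq0.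
have -> : (rnum r)%:F = (rden r)%:F * r :> K.
  by rewrite mulrC; apply: (canRL (divfK d0)); exact: rnum_div_rden.
by rewrite -mulrA (mulrC r).
Qed.

(** Allows composing through any fraction p / q for [r], reduced or not: by coprimality [rden r]
    divides [q], so it cannot vanish at [g] when [q] does not. *)
Lemma rcomp_frac (r g : K) (p q : {poly F}) :
  q%:F * r = p%:F -> evalr g q != 0 ->
  rcomp_def r g /\ rcomp r g = (evalr g q)^-1 * evalr g p.
Proof.
move=> /rnum_cross rE q0.
have /dvdpP [k qE] : rden r %| q.
  rewrite -(Gauss_dvdpr _ (_ : coprimep (rden r) (rnum r))).
    by rewrite rE dvdp_mulr.
  by rewrite coprimep_sym coprimep_rnum_rden.
have d0 : evalr g (rden r) != 0.
  by apply: contraNneq q0 => d0; rewrite qE rmorphM /= d0 mulr0.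
split=> //; change (evalr g (rnum r) / evalr g (rden r) = (evalr g q)^-1 * evalr g p).
have E : evalr g (rnum r) * evalr g q = evalr g (rden r) * evalr g p.
  by rewrite -!(rmorphM (evalr g)) rE.
move: (evalr g _) (evalr g _) (evalr g _) (evalr g _) E d0 q0 => n d u v E d0 q0.
by rewrite [RHS]mulrC; apply/eqP; rewrite (eqr_div _ _ d0 q0) E mulrC.
Qed.

Section Realization.
Variables (n p m : nat) (A : 'M[F]_n) (B : 'M[F]_(n, m)).
Variables (C : 'M[F]_(p, n)) (D : 'M[F]_(p, m)).

Lemma resolvent_unit : ('X%:F)%:M - map_mx (@ratc F) A \in unitmx.
Proof.
have c0 : (char_poly A)%:F != 0 :> K by rewrite tofrac_eq0 char_poly_neq0.
(* Only invertibility is wanted here; the identities are placeholders for [B] and [C]. *)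
by have [] := @map_transfer_num F K (@tofrac _) n n n A 1%:M 1%:M c0.
Qed.

Lemma realizationE i j :
  (char_poly A)%:F * realization A B C D i j
  = (D i j *: char_poly A + transfer_num A B C i j)%:F.
Proof.
have c0 : (char_poly A)%:F != 0 :> K by rewrite tofrac_eq0 char_poly_neq0.
have [_ E] := @map_transfer_num F K (@tofrac _) n p m A B C c0.
rewrite /realization mxE E !mxE mulrDr mulVKf // rmorphD /=; congr (_ + _).
by rewrite -mul_polyC rmorphM /= mulrC.
Qed.

Lemma evalr_resolvent_unit (g : K) :
  evalr g (char_poly A) != 0 -> g%:M - map_mx (@ratc F) A \in unitmx.
Proof.
move=> c0; have [] := @map_transfer_num F K (evalr g) n n n A 1%:M 1%:M c0.
have evX : (evalr g : {rmorphism _ -> _}) 'X = g := evalrX g.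
rewrite evX; have -> // : map_mx (evalr g \o polyC) A = map_mx (@ratc F) A.
by apply/matrixP=> i j; rewrite !mxE /= evalrC.
Qed.

Lemma mxrcomp_realization (g : K) :
  evalr g (char_poly A) != 0 ->
  let G := realization A B C D in
  mxrcomp_def G g /\
  mxrcomp G g = map_mx (@ratc F) D
    + map_mx (@ratc F) C *m invmx (g%:M - map_mx (@ratc F) A) *m map_mx (@ratc F) B.
Proof.
move=> c0 G; have rE i j := rcomp_frac (realizationE i j) c0.
split=> [i j|]; first by have [] := rE i j.
have [_ E] := @map_transfer_num F K (evalr g) n p m A B C c0.
have evC k l (M : 'M[F]_(k, l)) : map_mx (evalr g \o polyC) M = map_mx (@ratc F) M.
  by apply/matrixP=> i j; rewrite !mxE /= evalrC.
have evX : (evalr g : {rmorphism _ -> _}) 'X = g := evalrX g.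
rewrite !evC evX in E; rewrite E.
apply/matrixP=> i j; rewrite [LHS]mxE; have [_ ->] := rE i j.
rewrite -mul_polyC rmorphD /= rmorphM /= evalrC mulrDr mulrCA mulVf // mulr1.
by rewrite !mxE.
Qed.

(** The strictly proper part r - D in reduced form: its numerator L satisfies L q = (rden r) P with
    q = [char_poly A] and deg P < deg q, hence deg L < deg (rden r). *)
Lemma realization_sub i j (r := realization A B C D i j) :
  (size (rnum r - D i j *: rden r)%R < size (rden r))%N.
Proof.
have /rnum_cross := realizationE i j; rewrite -/r => rE.
set L := rnum r - _; have p0 := char_poly_neq0 A; have d0 := rden_neq0 r.
have LE : L * char_poly A = rden r * transfer_num A B C i j.
  by rewrite mulrBl rE mulrDr -scalerAl -scalerAr addrAC subrr add0r.
have lt := size_transfer_num A B C i j.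
have [->|L0] := eqVneq L 0; first by rewrite size_poly0 size_poly_gt0.
have N0 : transfer_num A B C i j != 0.
  apply: contraNneq L0 => N0; move/eqP: LE.
  by rewrite N0 mulr0 mulf_eq0 (negPf p0) orbF.
(* The successor cancels the predecessor in the size of a product. *)
have := congr1 (fun s : {poly F} => (size s).+1) LE.
rewrite !size_mul // !prednK ?addn_gt0 ?size_poly_gt0 ?L0 ?d0 // => sE.
by rewrite -(ltn_add2r (size (char_poly A))) sE ltn_add2l.
Qed.

(** Otherwise the numerator would be a nonzero multiple of [char_poly A], against its smaller
    degree. *)
Lemma realization_neq_const i j c : c != D i j -> realization A B C D i j != ratc c.
Proof.
move=> cD; apply/eqP => rc; have := realizationE i j.
rewrite rc mulrC -tofracM mul_polyC => /eqP; rewrite tofrac_eq => /eqP E.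
have := size_transfer_num A B C i j.
have -> : transfer_num A B C i j = (c - D i j) *: char_poly A.
  by rewrite scalerBl E addrAC subrr add0r.
by rewrite size_scale ?ltnn // subr_eq0.
Qed.

End Realization.

End RationalFunctions.

(** * Algebra of Kronecker products with a column or a row *)

Section KroneckerVectors.
Variable K : comPzRingType.

Lemma kron_colE n1 m n2 (M : 'M[K]_(n1, m)) (b : 'cV[K]_n2) i j :
  kron_col M b i j = M (mxtens_unindex i).1 j * b (mxtens_unindex i).2 0.
Proof.
rewrite castmxE mxE cast_ord_id; congr (M _ _ * b _ _); last exact: ord1.
by apply: val_inj; rewrite /= divn1.
Qed.

Lemma kron_colBl n1 m n2 (M N : 'M[K]_(n1, m)) (b : 'cV[K]_n2) :
  kron_col (M - N) b = kron_col M b - kron_col N b.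
Proof. by apply/matrixP=> i j; rewrite !mxE !kron_colE !mxE mulrBl. Qed.

Lemma kron_colBr n1 m n2 (M : 'M[K]_(n1, m)) (a b : 'cV[K]_n2) :
  kron_col M (a - b) = kron_col M a - kron_col M b.
Proof. by apply/matrixP=> i j; rewrite !mxE !kron_colE !mxE mulrBr. Qed.

Lemma kron_colZl n1 m n2 x (M : 'M[K]_(n1, m)) (b : 'cV[K]_n2) :
  kron_col (x *: M) b = x *: kron_col M b.
Proof. by apply/matrixP=> i j; rewrite !mxE !kron_colE !mxE mulrA. Qed.

Lemma kron_colZr n1 m n2 x (M : 'M[K]_(n1, m)) (b : 'cV[K]_n2) :
  kron_col M (x *: b) = x *: kron_col M b.
Proof. by apply/matrixP=> i j; rewrite !mxE !kron_colE !mxE mulrCA. Qed.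

Lemma tensmx_kron_col q1 n1 m q2 n2 (M : 'M[K]_(q1, n1)) (T : 'M[K]_(q2, n2))
    (N : 'M[K]_(n1, m)) (b : 'cV[K]_n2) :
  (M *t T) *m kron_col N b = kron_col (M *m N) (T *m b).
Proof. by rewrite /kron_col -tensmx_mul castmx_mul castmx_id. Qed.

Lemma kron_row_col p n1 m n2 (M : 'M[K]_(p, n1)) (c : 'rV[K]_n2)
    (N : 'M[K]_(n1, m)) (b : 'cV[K]_n2) :
  kron_row M c *m kron_col N b = (c *m b) 0 0 *: (M *m N).
Proof.
rewrite /kron_row /kron_col.
have <- := castmx_mul (muln1 p) (muln1 m) (M *t c) (N *t b).
(* The second factor of the mixed product is 1 x 1, so tensoring with it is a scaling. *)
by rewrite tensmx_mul [in LHS](mx11_scalar (c *m b)) tens_mx_scalar castmxKV.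
Qed.

End KroneckerVectors.

Lemma map_kron_col (aR rR : pzRingType) (f : {rmorphism aR -> rR}) n1 m n2
    (M : 'M[aR]_(n1, m)) (b : 'cV[aR]_n2) :
  map_mx f (kron_col M b) = kron_col (map_mx f M) (map_mx f b).
Proof. by rewrite /kron_col map_castmx map_mxT. Qed.

Lemma map_kron_row (aR rR : pzRingType) (f : {rmorphism aR -> rR}) p n1 n2
    (M : 'M[aR]_(p, n1)) (c : 'rV[aR]_n2) :
  map_mx f (kron_row M c) = kron_row (map_mx f M) (map_mx f c).
Proof. by rewrite /kron_row map_castmx map_mxT. Qed.

(** * The realization formula for the composition *)

Section CompositionFormula.
Variables (K : fieldType) (n1 m p n2 : nat).
Variables (A1 : 'M[K]_n1) (B1 : 'M[K]_(n1, m)) (C1 : 'M[K]_(p, n1)).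
Variables (D1 : 'M[K]_(p, m)).
Variables (A2 : 'M[K]_n2) (b2 : 'cV[K]_n2) (c2 : 'rV[K]_n2) (d2 x g : K).
Let N := invmx (A1 - d2%:M).
Let A := 1%:M *t A2 + N *t (b2 *m c2).

(* The state of the composition is [Y *t v], where [Y] is the state of [G1] at
   the point [g] and [v] the state of [g2] at [x]. *)
Lemma kron_realization :
    A1 - d2%:M \in unitmx -> x%:M - A2 \in unitmx ->
    g%:M - A1 \in unitmx -> x%:M - A \in unitmx ->
    g%:M = d2%:M + c2 *m invmx (x%:M - A2) *m b2 :> 'M_1 ->
  D1 + C1 *m invmx (g%:M - A1) *m B1
  = D1 - C1 *m N *m B1
    + kron_row (C1 *m N) c2 *m invmx (x%:M - A) *m kron_col (- (N *m B1)) b2.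
Proof.
move=> uN u2 u1 uA gE.
set v := invmx (x%:M - A2) *m b2; set Y := invmx (g%:M - A1) *m B1.
(* The strictly proper part of g2 at [x], that is g - d2. *)
set w := (c2 *m v) 0 0.
have wE : c2 *m v = w%:M by exact: mx11_scalar.
have {}gE : g = d2 + w.
  by move/matrixP/(_ 0 0): gE; rewrite -mulmxA wE !mxE eqxx !mulr1n.
have vE : x *: v - A2 *m v = b2.
  by rewrite -mul_scalar_mx -mulmxBl mulKVmx.
(* Multiply (g I - A1) Y = B1 by N on the left, with g I - A1 = w I - (A1 - d2 I). *)
have YE : Y - w *: (N *m Y) = - (N *m B1).
  have -> : B1 = (g%:M - A1) *m Y by rewrite mulKVmx.
  have -> : g%:M - A1 = w%:M - (A1 - d2%:M).
    by rewrite gE raddfD /= opprB addrA [w%:M + _]addrC.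
  by rewrite mulmxBl mulmxBr mulKmx // opprB mul_scalar_mx -scalemxAr.
(* State equation of the composition. The left side is Y tensor (x v - A2 v) minus w N Y tensor b2,
   where x v - A2 v = b2; so it equals (Y - w N Y) tensor b2. *)
have XE : (x%:M - A) *m kron_col Y v = kron_col (- (N *m B1)) b2.
  rewrite mulmxBl mul_scalar_mx mulmxDl !tensmx_kron_col mul1mx -mulmxA wE.
  rewrite mul_mx_scalar opprD addrA -[x *: _]kron_colZr -kron_colBr vE.
  by rewrite kron_colZr -kron_colZl -kron_colBl YE.
(* The output map sends the state to w C1 N Y, and w N Y - N B1 = Y. *)
rewrite -(mulmxA (kron_row _ _)) -XE mulKmx // kron_row_col -/w -addrA; congr (_ + _).
rewrite -mulmxA -/Y -!mulmxA -mulmxN scalemxAr -mulmxDr.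
by congr (_ *m _); rewrite -YE subrK.
Qed.

End CompositionFormula.

(** The pointwise formula [kron_realization] is used over the field of rational functions itself,
    with [x] the indeterminate and constant matrices embedded by [ratc]. *)
Lemma realization_kron (F : fieldType) n1 m p n2 (A1 : 'M[F]_n1)
    (B1 : 'M[F]_(n1, m)) (C1 : 'M[F]_(p, n1)) (D1 : 'M[F]_(p, m))
    (A2 : 'M[F]_n2) (b2 : 'cV[F]_n2) (c2 : 'rV[F]_n2) (d2 : F) (g : ratfun F)
    (N := invmx (A1 - d2%:M)) :
    A1 - d2%:M \in unitmx -> g%:M - map_mx (@ratc F) A1 \in unitmx ->
    g%:M = realization A2 b2 c2 d2%:M :> 'M_1 ->
  realization (1%:M *t A2 + N *t (b2 *m c2)) (kron_col (- (N *m B1)) b2)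
    (kron_row (C1 *m N) c2) (D1 - C1 *m N *m B1)
  = map_mx (@ratc F) D1 + map_mx (@ratc F) C1
    *m invmx (g%:M - map_mx (@ratc F) A1) *m map_mx (@ratc F) B1.
Proof.
move=> uN u1 gE; set A := 1%:M *t A2 + _.
have uA := resolvent_unit A; have u2 := resolvent_unit A2.
have dE : map_mx (@ratc F) A1 - (ratc d2)%:M = map_mx (@ratc F) (A1 - d2%:M).
  by rewrite map_mxB map_scalar_mx.
have rN : invmx (map_mx (@ratc F) A1 - (ratc d2)%:M) = map_mx (@ratc F) N.
  by rewrite map_invmx dE.
have uN' : map_mx (@ratc F) A1 - (ratc d2)%:M \in unitmx.
  by rewrite dE map_unitmx.
have rA : map_mx (@ratc F) A = 1%:M *t map_mx (@ratc F) A2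
    + map_mx (@ratc F) N *t (map_mx (@ratc F) b2 *m map_mx (@ratc F) c2).
  by rewrite map_mxD !map_mxT map_mx1 map_mxM.
rewrite rA -rN in uA.
rewrite /realization map_scalar_mx in gE.
have E := kron_realization (map_mx (@ratc F) B1) (map_mx (@ratc F) C1)
  (map_mx (@ratc F) D1) uN' u2 u1 uA gE.
by rewrite E /realization rA map_kron_col map_kron_row map_mxN map_mxB !map_mxM -rN.
Qed.

(** * Growth of polynomials and properness of realizations *)

Section Growth.
Variable F : numFieldType.

(** The extra factor |z| on the left makes up for the size exceeding the degree by one, and spares a
    separate case for p = 0. *)
Lemma horner_norm_leq (p : {poly F}) k : (size p <= k)%N ->
  exists2 T : F, 0 <= T & forall z, 1 <= `|z| -> `|p.[z]| * `|z| <= T * `|z| ^+ k.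
Proof.
move=> pk; exists (\sum_(i < size p) `|p`_i|) => [|z z1]; first exact: sumr_ge0.
rewrite horner_coef mulr_suml.
apply: le_trans (_ : (\sum_(i < size p) `|p`_i * z ^+ i|) * `|z| <= _).
  by rewrite ler_wpM2r // ler_norm_sum.
rewrite mulr_suml; apply: ler_sum => i _.
rewrite normrM normrX -mulrA -exprSr ler_wpM2l //.
by apply: ler_weXn2l => //; apply: leq_trans pk.
Qed.

Lemma horner_little_o (p q : {poly F}) (e : F) : (size p < size q)%N -> 0 < e ->
  exists2 M : F, 0 <= M & forall z, M < `|z| -> `|p.[z]| < e * `|q.[z]|.
Proof.
move=> pq e0.
have q0 : q != 0 by rewrite -size_poly_gt0 (leq_ltn_trans _ pq).
(* Split [q] into its leading term and a remainder [l] of smaller degree. *)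
set k := (size q).-1; set a := lead_coef q; set l := q - a *: 'X^k.
have a0 : 0 < `|a| by rewrite normr_gt0 lead_coef_eq0.
have sq : size q = k.+1 by rewrite prednK // size_poly_gt0.
have lk : (size l <= k)%N.
  apply/leq_sizeP => j; rewrite leq_eqVlt coefB coefZ coefXn => /orP[/eqP<-|kj].
    by rewrite eqxx mulr1 subrr.
  by rewrite gtn_eqF // mulr0 subr0 nth_default // sq.
have pk : (size p <= k)%N by rewrite -ltnS -sq.
have [T T0 Tp] := horner_norm_leq pk; have [S S0 Sl] := horner_norm_leq lk.
have Q0 : 0 <= (T / e + S) / `|a|.
  by rewrite divr_ge0 // addr_ge0 // divr_ge0 // ltW.
(* The summand 1 gives |z| >= 1 for the bounds on [p] and [l]; the other gives T + e S < e |a|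
   |z|. *)
exists (1 + (T / e + S) / `|a|) => [|z Mz]; first by rewrite addr_ge0.
have z1 : 1 <= `|z| by apply: le_trans (ltW Mz); rewrite lerDl.
have z0 : 0 < `|z| by exact: lt_le_trans z1.
have zk : 0 < `|z| ^+ k by rewrite exprn_gt0.
have big : T + e * S < e * (`|a| * `|z|).
  have : (T / e + S) / `|a| < `|z| by apply: le_lt_trans Mz; rewrite lerDr.
  rewrite ltr_pdivrMr // [`|z| * _]mulrC => h.
  by rewrite -(ltr_pM2l e0) mulrDr mulrCA divff ?gt_eqF // mulr1 in h.
have qz : `|a| * `|z| ^+ k <= `|q.[z]| + `|l.[z]|.
  have -> : `|a| * `|z| ^+ k = `|q.[z] - l.[z]|.
    by rewrite -hornerN -hornerD opprB addrC subrK hornerZ hornerXn normrM normrX.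
  exact: ler_normB.
rewrite -(ltr_pM2r z0); apply: le_lt_trans (Tp z z1) _.
(* With e |l(z)| |z| added, the left side is at most (T + e S) |z|^k < e |a| |z|^(k+1), and |a|
   |z|^k <= |q(z)| + |l(z)|. *)
rewrite -(ltrD2r (e * (`|l.[z]| * `|z|))).
apply: le_lt_trans (_ : _ <= T * `|z| ^+ k + e * (S * `|z| ^+ k)) _.
  by rewrite lerD2l ler_pM2l // Sl.
apply: lt_le_trans (_ : e * (`|a| * `|z| ^+ k * `|z|) <= _).
  rewrite [e * (S * _)]mulrA -mulrDl [X in _ < e * X]mulrAC mulrA.
  by rewrite ltr_pM2r // big.
by rewrite -[X in _ <= X + _]mulrA -mulrDr ler_pM2l // -mulrDl ler_wpM2r.
Qed.

End Growth.

Lemma realization_rproper (R : realType) n p m (A : 'M[R[i]]_n)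
    (B : 'M[R[i]]_(n, m)) (C : 'M[R[i]]_(p, n)) (D : 'M[R[i]]_(p, m)) :
  mxrproper (realization A B C D).
Proof.
move=> i j; exists (D i j) => e e0; set r := realization A B C D i j.
have e0C : 0 < e%:C by rewrite ltcR.
have [M M0 Mb] := horner_little_o (realization_sub A B C D i j) e0C.
(* The bound [M] lives in the complex field; being nonnegative, it comes from a real number. *)
have /complex_realP [M' ME] := ger0_real M0.
exists M' => z; rewrite -ME => /Mb; rewrite -/r => lt dz.
rewrite /rval -[D i j](mulfK dz) -mulrBl normrM normfV.
rewrite ltr_pdivrMr ?normr_gt0 //.
by move: lt; rewrite hornerD hornerN hornerZ.
Qed.

(** * Nonvanishing of the denominator at g2, and conclusion *)

Lemma evalr_char_poly_neq0 (F : closedFieldType) n (A : 'M[F]_n) (g : ratfun F) :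
  (forall a, eigenvalue A a -> g != ratc a) -> evalr g (char_poly A) != 0.
Proof.
move=> gA; have [s sE] := closed_field_poly_normal (char_poly A).
have rs a : a \in s -> root (char_poly A) a.
  by rewrite sE (monicP (char_poly_monic A)) scale1r root_prod_XsubC.
rewrite sE (monicP (char_poly_monic A)) scale1r rmorph_prod /=.
rewrite prodf_seq_neq0; apply/allP => a as_; rewrite rmorphB /= evalrX evalrC.
by rewrite subr_eq0 gA // eigenvalue_root_char rs.
Qed.

Theorem proposition3p2 (R : realType) (n1 m1 p1 n2 : nat)
  (G1 : 'M[ratfun R[i]]_(p1, m1)) (g2 : ratfun R[i])
  (A1 : 'M[R[i]]_n1) (B1 : 'M[R[i]]_(n1, m1))
  (C1 : 'M[R[i]]_(p1, n1)) (D1 : 'M[R[i]]_(p1, m1))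
  (A2 : 'M[R[i]]_n2) (b2 : 'cV[R[i]]_n2) (c2 : 'rV[R[i]]_n2) (d2 : R[i])
  (hG1 : mxrproper G1) (hg2 : rproper g2)
  (hG1r : G1 = realization A1 B1 C1 D1)
  (hg2r : g2%:M = realization A2 b2 c2 d2%:M :> 'M_1)
  (hd2 : ~~ eigenvalue A1 d2) :
  let N := invmx (A1 - d2%:M) in
  let A : 'M[R[i]]_(n1 * n2) := 1%:M *t A2 + N *t (b2 *m c2) in
  let B : 'M[R[i]]_(n1 * n2, m1) := kron_col (- (N *m B1)) b2 in
  let C : 'M[R[i]]_(p1, n1 * n2) := kron_row (C1 *m N) c2 in
  let D : 'M[R[i]]_(p1, m1) := D1 - C1 *m N *m B1 in
  [/\ mxrcomp_def G1 g2,
      mxrproper (mxrcomp G1 g2)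
    & mxrcomp G1 g2 = realization A B C D].
Proof.
move=> N A B C D.
have g2E : g2 = realization A2 b2 c2 d2%:M 0 0 by rewrite -hg2r mxE eqxx mulr1n.
have c0 : evalr g2 (char_poly A1) != 0.
  apply: evalr_char_poly_neq0 => a eiga; rewrite g2E; apply: realization_neq_const.
  by rewrite mxE eqxx mulr1n; apply: contraNneq hd2 => <-.
have [Gdef GE] := mxrcomp_realization B1 C1 D1 c0; rewrite -hG1r in Gdef GE.
(* Properness comes for free, since every realization is proper. *)
suff E : mxrcomp G1 g2 = realization A B C D.
  by split=> //; rewrite E; apply: realization_rproper.
(* As d2 is not an eigenvalue, the kernel of A1 - d2 I is trivial. *)
have uN : A1 - d2%:M \in unitmx.
  by move: hd2; rewrite /eigenvalue negbK /eigenspace kermx_eq0 row_free_unit.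
have u1 := evalr_resolvent_unit c0.
by rewrite GE; symmetry; apply: realization_kron.
Qed.
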